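(* Let $D$ be a strongly connected digraph whose line digraph $LD$ has minimum in-degree $\delta^-\ge 2$. Then $LD$ does not admit a $(1,\le 3)$-identifying code.
   Context: Digraphs are finite, without loops or multiple arcs; digons (both arcs $(u,v)$ and $(v,u)$) are allowed. $N^-(u)$ and $N^+(u)$ are the in- and out-neighbourhoods, $N^-[u]=\{u\}\cup N^-(u)$, $N^+[u]=\{u\}\cup N^+(u)$, and $N^{\pm}[U]=\bigcup_{u\in U}N^{\pm}[u]$. The line digraph $LD$ of $D$ has vertex set the arc set of $D$, and a vertex $uv$ (for the arc $(u,v)$) is adjacent to $wz$ if and only if $v=w$. For an integer $\ell\ge1$, a $(1,\le\ell)$-identifying code in a digraph $G$ is a set $C\subseteq V(G)$ that is dominating ($N^+[C]=V(G)$) and such that $N^-[X]\cap C\ne N^-[Y]\cap C$ for all distinct $X,Y\subseteq V(G)$ with $1\le|X|,|Y|\le\ell$. $G$ admits a $(1,\le \ell)$-identifying code if one exists; equivalently, if $N^-[X]\neq N^-[Y]$ for all such distinct $X,Y$. *)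

(* Defs.v *)
From mathcomp Require Import all_boot.

Set Implicit Arguments.
Unset Strict Implicit.
Unset Printing Implicit Defensive.

Record digraph : Type := Digraph {
  vertex :> finType;
  arc : rel vertex;
  arc_irrefl : irreflexive arc
}.

Section Digraph.
Variable G : digraph.
Implicit Types (u v : G) (U C X Y : {set G}).

Definition in_nbhd u : {set G} := [set v | arc v u].
Definition out_nbhd u : {set G} := [set v | arc u v].
Definition in_cnbhd u : {set G} := u |: in_nbhd u.
Definition out_cnbhd u : {set G} := u |: out_nbhd u.
Definition in_cnbhds U : {set G} := \bigcup_(u in U) in_cnbhd u.
Definition out_cnbhds U : {set G} := \bigcup_(u in U) out_cnbhd u.

Definition in_degree u : nat := #|in_nbhd u|.

(* An in-degree never exceeds #|G|, so starting the minimum at #|G| leaves it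
   unchanged when G has a vertex; a digraph with no vertex gets the value 0. *)
Definition min_in_degree : nat := \big[minn/#|G|]_(u : G) in_degree u.

Definition strongly_connected : Prop := forall u v, connect (@arc G) u v.

Definition dominating C : Prop := out_cnbhds C = [set: G].

Definition identifying_code (l : nat) C : Prop :=
  dominating C /\
  forall X Y, X != Y -> 1 <= #|X| <= l -> 1 <= #|Y| <= l ->
    in_cnbhds X :&: C <> in_cnbhds Y :&: C.

Definition admits_identifying_code (l : nat) : Prop :=
  exists C : {set G}, identifying_code l C.

End Digraph.

Section LineDigraph.
Variable D : digraph.

Definition line_vertex : finType := {p : D * D | arc p.1 p.2}.

Definition line_arc : rel line_vertex :=
  fun a b => (val a).2 == (val b).1.

Lemma line_arc_irrefl : irreflexive line_arc.
Proof.
move=> [[u v] /= uv]; apply/negbTE/eqP => /= vu.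
by move: uv; rewrite vu arc_irrefl.
Qed.

Definition line_digraph : digraph := Digraph line_arc_irrefl.

End LineDigraph.

(* Main.v *)
(** If an arc [ab] of [D] has a sibling [az] (same tail, [z != b]) and [by] is
    any arc, then [ab] and [az] have the same in-neighbours in [LD] and [ab] is
    an in-neighbour of [by], so [{ab, az, by}] and [{az, by}] have the same
    closed in-neighbourhood.  Such a sibling exists: otherwise every vertex has
    a unique out-neighbour, and this map from [V(D)] to itself is surjective,
    hence injective, against in-degrees being at least 2. *)

Require Import Defs.
From mathcomp Require Import all_boot.

Set Implicit Arguments.
Unset Strict Implicit.
Unset Printing Implicit Defensive.

(** The conjunct [n <= #|G|] comes from the starting value of the minimum; for [n > 0] it provides a
    vertex of [G]. *)
Lemma min_in_degree_geP (G : digraph) n :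
  reflect (n <= #|G| /\ forall u : G, n <= in_degree u) (n <= min_in_degree G).
Proof.
rewrite /min_in_degree.
have -> : (n <= \big[minn/#|G|]_(u : G) in_degree u)
    = (n <= #|G|) && all (fun u : G => n <= in_degree u) (index_enum G).
  elim: (index_enum G) => [|u s IHs]; first by rewrite big_nil andbT.
  by rewrite big_cons leq_min IHs /= andbCA.
apply: (iffP andP) => -[leG leV]; split=> //.
  by move=> u; rewrite (allP leV) ?mem_index_enum.
by apply/allP=> u _.
Qed.

Lemma twin_no_identifying_code (G : digraph) (x y z : G) :
  x != y -> in_nbhd x = in_nbhd y -> Defs.arc x z ->
  ~ admits_identifying_code G 3.
Proof.
move=> xy twin xz [C [_ sepC]].
have x'z : x != z by apply: contraTneq xz => ->; rewrite arc_irrefl.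
have xNyz : x \notin [set y; z] by rewrite !inE negb_or xy.
have card_yz : 0 < #|[set y; z]| <= 2 by rewrite cards2; case: (_ != _).
(* The vertex [x] lies in N^-[z] through the arc [xz], and the rest of N^-[x] is N^-(y), so adding
   [x] contributes nothing new. *)
have eqN : in_cnbhds (x |: [set y; z]) = in_cnbhds [set y; z].
  rewrite /in_cnbhds big_setU1 //=; apply/setUidPr; rewrite subUset sub1set.
  apply/andP; split.
    by apply/bigcupP; exists z; rewrite !inE ?eqxx ?xz orbT.
  rewrite twin; apply: (bigcup_max y); first by rewrite !inE eqxx.
  exact: subsetUr.
case/andP: card_yz => yz_gt0 yz_le2.
apply: (sepC (x |: [set y; z]) [set y; z]); last by rewrite eqN.
- by apply: contraNneq xNyz => <-; rewrite setU11.
- by rewrite cardsU1 xNyz.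
- by rewrite yz_gt0 ltnW.
Qed.

Lemma strongly_connected_out_arc (D : digraph) (u v : D) :
  strongly_connected D -> u != v -> exists w, Defs.arc u w.
Proof.
move=> strong uv; case/connectP: (strong u v) => [[|w p]] /=.
  by move=> _ vu; rewrite vu eqxx in uv.
by case/andP=> uw _ _; exists w.
Qed.

Lemma two_out_arcs (D : digraph) (u0 : D) :
  (forall u : D, exists v, Defs.arc u v) -> (forall u : D, 2 <= in_degree u) ->
  exists u v w : D, [/\ Defs.arc u v, Defs.arc u w & v != w].
Proof.
move=> out_arc in2.
have in_arc (u : D) : exists v, Defs.arc v u.
  by case/card_gt0P: (ltnW (in2 u)) => v; rewrite inE; exists v.
have [/existsP[u /existsP[v /existsP[w /and3P[uv uw vw]]]]|] :=
  boolP [exists u : D, exists v : D, exists w : D,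
           [&& Defs.arc u v, Defs.arc u w & v != w]].
  by exists u, v, w.
move=> /existsPn out1.
have out_uniq (u v w : D) : Defs.arc u v -> Defs.arc u w -> v = w.
  move=> uv uw; apply/eqP; apply: contraT => vw.
  move/existsPn: (out1 u) => /(_ v) /existsPn /(_ w).
  by rewrite uv uw vw.
pose f u := xchoose (out_arc u); pose g u := xchoose (in_arc u).
have gK : cancel g f.
  by move=> u; apply: (out_uniq (g u)); [|exact: (xchooseP (in_arc u))];
    exact: xchooseP.
(* On a finite set, [cancel g f] yields [cancel f g]; since [f w = u0] for each in-neighbour [w] of
   [u0], it follows that [w = g u0]. *)
have in_uniq (w : D) : Defs.arc w u0 -> w = g u0.
  move=> wu; rewrite -[w](canF_sym gK); congr g.
  by apply: (out_uniq w) wu; exact: xchooseP.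
case/card_gt1P: (in2 u0) => w1 [w2 []].
by rewrite !inE => /in_uniq-> /in_uniq->; rewrite eqxx.
Qed.

Theorem proposition2p2 (D : digraph)
  (D_strong : strongly_connected D)
  (LD_min_in_degree : 2 <= min_in_degree (line_digraph D)) :
  ~ admits_identifying_code (line_digraph D) 3.
Proof.
have [LD_gt1 LD_in2] := min_in_degree_geP _ _ LD_min_in_degree.
have [[[p q] /= pq] _] := card_gt0P (ltnW LD_gt1).
have p_neq_q : p != q by apply: contraTneq pq => ->; rewrite arc_irrefl.
(* A path to [p] begins with an arc out of [u], except for [u = p], where the arc to [q] serves. *)
have out_arc (u : D) : exists v, Defs.arc u v.
  have [up|u'p] := eqVneq u p; first by exists q; rewrite up.
  exact: strongly_connected_out_arc D_strong u'p.
(* The in-neighbours of the arc [uv] in the line digraph are the arcs entering [u]; taking tails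
   maps them injectively into N^-(u). *)
have in2 (u : D) : 2 <= in_degree u.
  have [v uv] := out_arc u; pose e : line_digraph D := Sub (u, v) uv.
  apply: leq_trans (LD_in2 e) _.
  rewrite /in_degree -(card_in_imset (f := fun a : line_digraph D => (val a).1)).
    apply/subset_leq_card/subsetP=> _ /imsetP[[[w x] /= wx] + ->].
    by rewrite !inE => /eqP /= <-.
  move=> [[w x] wx] [[w' x'] wx'] /=; rewrite !inE => /eqP /= xu /eqP /= x'u ww.
  by apply: val_inj; rewrite /= xu x'u ww.
have [a [b [z [ab az bz]]]] := two_out_arcs p out_arc in2.
have [y b_y] := out_arc b.
pose eab : line_digraph D := Sub (a, b) ab.
pose eaz : line_digraph D := Sub (a, z) az.
pose eby : line_digraph D := Sub (b, y) b_y.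
apply: (@twin_no_identifying_code _ eab eaz eby).
- by apply: contra bz => /eqP/(congr1 val)[->].
- by apply/setP=> e; rewrite !inE.
- exact: eqxx.
Qed.
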